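(* (Subject reduction for Proto-Quipper-M.) Let $Q,Q'$ be label contexts, $(C,M)$ a configuration and $A$ a type. If $Q\vdash(C,M):A;Q'$ and $(C,M)\Downarrow(C',V)$, then $Q\vdash(C',V):A;Q'$.
   Context: **Labelled circuits.** Fix a symmetric monoidal category $\mathbf M$, a set $\mathcal W$ of wire types with a function $[\![-]\!]:\mathcal W\to\mathrm{Ob}(\mathbf M)$, and a countably infinite totally ordered set $\mathcal L$ of labels. A label context is a function $Q=\ell_1{:}\alpha_1,\dots,\ell_n{:}\alpha_n$ from a finite set of labels to wire types; $[\![Q]\!]=[\![\alpha_1]\!]\otimes\dots\otimes[\![\alpha_n]\!]$ with $\ell_1<\dots<\ell_n$ ($I$ if empty). The category $\mathbf M_{\mathcal L}$ has label contexts as objects, and a morphism $Q\to Q'$ (a labelled circuit) is a morphism $[\![Q]\!]\to[\![Q']\!]$ of $\mathbf M$; it carries the symmetric monoidal structure (unique up to isomorphism) making $[\![-]\!]:\mathbf M_{\mathcal L}\to\mathbf M$ a full and faithful symmetric monoidal functor. For disjoint domains, $Q\otimes Q'\cong Q\cup Q'$. A wire-type-preserving bijection of labels $Q\to\tilde Q$ induces a canonical symmetry isomorphism $Q\to\tilde Q$ (a renaming). **Syntax.** Types: $A,B::=\alpha\mid 0\mid A+B\mid I\mid A\otimes B\mid A\multimap B\mid{!A}\mid\mathsf{nat}\mid\mathsf{list}\,A\mid\mathrm{Circ}(T,U)$ with $\alpha\in\mathcal W$. Parameter types: $P,R::=0\mid P+R\mid I\mid P\otimes R\mid{!A}\mid\mathsf{nat}\mid\mathsf{list}\,P\mid\mathrm{Circ}(T,U)$.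 Simple M-types: $T,U::=\alpha\mid I\mid T\otimes U$. Terms: $M,N,P::=x\mid\ell\mid c\mid\mathsf{let}\,x=M\,\mathsf{in}\,N\mid\Box_AM\mid\mathsf{left}_{A,B}M\mid\mathsf{right}_{A,B}M\mid\mathsf{case}\,M\,\mathsf{of}\,\{\mathsf{left}\,x\to N\mid\mathsf{right}\,y\to P\}\mid *\mid M;N\mid\langle M,N\rangle\mid\mathsf{let}\,\langle x,y\rangle=M\,\mathsf{in}\,N\mid\lambda x^A.M\mid MN\mid\mathsf{lift}\,M\mid\mathsf{force}\,M\mid\mathsf{box}_TM\mid\mathsf{apply}(M,N)\mid(\vec\ell,C,\vec\ell')$, where $x$ ranges over variables, $\ell$ over labels, $c$ over a given set of constants (these sets being pairwise disjoint), and $C$ over morphisms of $\mathbf M_{\mathcal L}$. Label tuples: $\vec\ell,\vec k::=\ell\mid *\mid\langle\vec\ell,\vec k\rangle$. Values: $V,W::=x\mid\ell\mid c\mid\mathsf{left}_{A,B}V\mid\mathsf{right}_{A,B}V\mid *\mid\langle V,W\rangle\mid\lambda x^A.M\mid\mathsf{lift}\,M\mid(\vec\ell,C,\vec\ell')$. **Typing.** Judgements $\Gamma;Q\vdash M:A$, with $\Gamma$ a variable context (finite map from variables to types) and $Q$ a label context. $\Phi$ always denotes a variable context all of whose types are parameter types; a comma denotes union of contexts with disjoint domains. Each constant $c$ has a fixed type $A_c$. Rules (premises $\Rightarrow$ conclusion): - $\Phi,x{:}A;\emptyset\vdash x:A$; $\ \Phi;\ell{:}\alpha\vdash\ell:\alpha$;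 $\ \Phi;\emptyset\vdash c:A_c$; $\ \Phi;\emptyset\vdash *:I$. - $\Phi,\Gamma_1;Q_1\vdash M:A$ and $\Phi,\Gamma_2,x{:}A;Q_2\vdash N:B$ $\Rightarrow$ $\Phi,\Gamma_1,\Gamma_2;Q_1,Q_2\vdash\mathsf{let}\,x=M\,\mathsf{in}\,N:B$. - $\Gamma;Q\vdash M:0$ $\Rightarrow$ $\Gamma;Q\vdash\Box_AM:A$. - $\Gamma;Q\vdash M:A$ $\Rightarrow$ $\Gamma;Q\vdash\mathsf{left}_{A,B}M:A+B$; and $\Gamma;Q\vdash M:B$ $\Rightarrow$ $\Gamma;Q\vdash\mathsf{right}_{A,B}M:A+B$. - $\Phi,\Gamma_1;Q_1\vdash M:A+B$, $\Phi,\Gamma_2,x{:}A;Q_2\vdash N:D$ and $\Phi,\Gamma_2,y{:}B;Q_2\vdash P:D$ $\Rightarrow$ $\Phi,\Gamma_1,\Gamma_2;Q_1,Q_2\vdash\mathsf{case}\,M\,\mathsf{of}\,\{\mathsf{left}\,x\to N\mid\mathsf{right}\,y\to P\}:D$. - $\Phi,\Gamma_1;Q_1\vdash M:I$ and $\Phi,\Gamma_2;Q_2\vdash N:A$ $\Rightarrow$ $\Phi,\Gamma_1,\Gamma_2;Q_1,Q_2\vdash M;N:A$. - $\Phi,\Gamma_1;Q_1\vdash M:A$ and $\Phi,\Gamma_2;Q_2\vdash N:B$ $\Rightarrow$ $\Phi,\Gamma_1,\Gamma_2;Q_1,Q_2\vdash\langle M,N\rangle:A\otimes B$. - $\Phi,\Gamma_1;Q_1\vdash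 M:A\otimes B$ and $\Phi,\Gamma_2,x{:}A,y{:}B;Q_2\vdash N:D$ $\Rightarrow$ $\Phi,\Gamma_1,\Gamma_2;Q_1,Q_2\vdash\mathsf{let}\,\langle x,y\rangle=M\,\mathsf{in}\,N:D$. - $\Gamma,x{:}A;Q\vdash M:B$ $\Rightarrow$ $\Gamma;Q\vdash\lambda x^A.M:A\multimap B$. - $\Phi,\Gamma_1;Q_1\vdash M:A\multimap B$ and $\Phi,\Gamma_2;Q_2\vdash N:A$ $\Rightarrow$ $\Phi,\Gamma_1,\Gamma_2;Q_1,Q_2\vdash MN:B$. - $\Phi;\emptyset\vdash M:A$ $\Rightarrow$ $\Phi;\emptyset\vdash\mathsf{lift}\,M:{!A}$; and $\Gamma;Q\vdash M:{!A}$ $\Rightarrow$ $\Gamma;Q\vdash\mathsf{force}\,M:A$. - $\Gamma;Q\vdash M:{!(T\multimap U)}$ $\Rightarrow$ $\Gamma;Q\vdash\mathsf{box}_TM:\mathrm{Circ}(T,U)$. - $\Phi,\Gamma_1;Q_1\vdash M:\mathrm{Circ}(T,U)$ and $\Phi,\Gamma_2;Q_2\vdash N:T$ $\Rightarrow$ $\Phi,\Gamma_1,\Gamma_2;Q_1,Q_2\vdash\mathsf{apply}(M,N):U$. - $\emptyset;Q\vdash\vec\ell:T$, $\emptyset;Q'\vdash\vec\ell':U$ and $C\in\mathbf M_{\mathcal L}(Q,Q')$ $\Rightarrow$ $\Phi;\emptyset\vdash(\vec\ell,C,\vec\ell'):\mathrm{Circ}(T,U)$. **Configurations.** A configuration is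 a pair $(C,M)$ of a labelled circuit and a term. $Q\vdash(C,M):A;Q'$ (well-typed with input labels $Q$, output labels $Q'$, type $A$) means: there is a label context $Q''$ disjoint from $Q'$ with $C:Q\to Q''\cup Q'$ in $\mathbf M_{\mathcal L}$ and $\emptyset;Q''\vdash M:A$. **Evaluation** $(C,M)\Downarrow(C',V)$, where $V$ is a value, is defined inductively, call-by-value, evaluating subterms left to right ($M[V/x]$ is capture-avoiding substitution): - $(C,V)\Downarrow(C,V)$ for $V$ a label, constant, $*$, $\lambda x^A.M$, $\mathsf{lift}\,M$ or boxed circuit $(\vec\ell,D,\vec\ell')$. - $(C,M)\Downarrow(C',V)$ and $(C',N[V/x])\Downarrow(C'',W)$ $\Rightarrow$ $(C,\mathsf{let}\,x=M\,\mathsf{in}\,N)\Downarrow(C'',W)$. - $(C,M)\Downarrow(C',V)$ $\Rightarrow$ $(C,\mathsf{left}_{A,B}M)\Downarrow(C',\mathsf{left}_{A,B}V)$; likewise $\mathsf{right}$. - $(C,M)\Downarrow(C',\mathsf{left}_{A,B}V)$ and $(C',N[V/x])\Downarrow(C'',W)$ $\Rightarrow$ $(C,\mathsf{case}\,M\,\mathsf{of}\,\{\mathsf{left}\,x\to N\mid\mathsf{right}\,y\to P\})\Downarrow(C'',W)$; symmetrically for $\mathsf{right}$ with $P[V/y]$. - $(C,M)\Downarrow(C',* )$ and $(C',N)\Downarrow(C'',W)$ $\Rightarrow$ $(C,M;N)\Downarrow(C'',W)$. - $(C,M)\Downarrow(C',V)$ and $(C',N)\Downarrow(C'',W)$ $\Rightarrow$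 $(C,\langle M,N\rangle)\Downarrow(C'',\langle V,W\rangle)$. - $(C,M)\Downarrow(C',\langle V_1,V_2\rangle)$ and $(C',N[V_1/x,V_2/y])\Downarrow(C'',W)$ $\Rightarrow$ $(C,\mathsf{let}\,\langle x,y\rangle=M\,\mathsf{in}\,N)\Downarrow(C'',W)$. - $(C,M)\Downarrow(C',\lambda x^A.M')$, $(C',N)\Downarrow(C'',V)$ and $(C'',M'[V/x])\Downarrow(C''',W)$ $\Rightarrow$ $(C,MN)\Downarrow(C''',W)$. (If $M$ evaluates to a value not of the form $\lambda x^A.M'$, then $MN$ evaluates to a separate outcome Error, not to a value configuration.) - $(C,M)\Downarrow(C',\mathsf{lift}\,M')$ and $(C',M')\Downarrow(C'',V)$ $\Rightarrow$ $(C,\mathsf{force}\,M)\Downarrow(C'',V)$. - $(C,M)\Downarrow(C',\mathsf{lift}\,N)$, $\mathrm{freshlabels}(T)=(Q,\vec\ell)$ and $(\mathrm{id}_Q,N\vec\ell)\Downarrow(D,\vec\ell')$ with $\vec\ell'$ a label tuple $\Rightarrow$ $(C,\mathsf{box}_TM)\Downarrow(C',(\vec\ell,D,\vec\ell'))$. Here $\mathrm{freshlabels}(T)$ returns a label context $Q$ and label tuple $\vec\ell$ with $\emptyset;Q\vdash\vec\ell:T$ whose labels do not occur in $N$. - $(C,M)\Downarrow(C',(\vec\ell,D,\vec\ell'))$, $(C',N)\Downarrow(C'',\vec k)$ and $\mathrm{append}(C'',\vec k,\vec\ell,D,\vec\ell')=(C''',\vec k')$ $\Rightarrow$ $(C,\mathsf{apply}(M,N))\Downarrow(C''',\vec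 k')$. Here $\mathrm{append}(C,\vec k,\vec\ell,D,\vec\ell')$, for $C:Q_0\to Q_1$, finds $D'$ and $\vec k'$ such that $(\vec k,D',\vec k')$ differs from $(\vec\ell,D,\vec\ell')$ only by a renaming of (input and output) labels and the labels of $\vec k'$ are fresh (in particular, not output labels of $C$), and returns $(C',\vec k')$, where $C'$ is $C$ followed by $D'$ applied to the outputs of $C$ named by $\vec k$ (tensored with the identity on the other outputs of $C$). It is undefined if this is impossible (e.g. $\vec k$ has repeated labels, labels that are not outputs of $C$, or mismatched shape or wire types). *)

(* Defs.v *)
From mathcomp Require Import all_boot all_order.
From mathcomp Require Import finmap.

Set Implicit Arguments.
Unset Strict Implicit.
Unset Printing Implicit Defensive.

Open Scope fset_scope.
Open Scope fmap_scope.

(* Symmetric monoidal categories, not assumed strict.  Composition is written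
   in diagrammatic order: [f ;; g] is "f, then g". *)

Declare Scope smc_scope.
Delimit Scope smc_scope with smc.

Reserved Notation "f ;; g" (at level 50, left associativity).
Reserved Notation "f \ox g" (at level 40, left associativity).

Record smc := SMC {
  ob :> Type;
  hom : ob -> ob -> Type;
  idm : forall a, hom a a;
  comp : forall a b c, hom a b -> hom b c -> hom a c
    where "f ;; g" := (comp f g);
  munit : ob;
  mtens : ob -> ob -> ob;
  mtensm : forall a b a' b',
    hom a b -> hom a' b' -> hom (mtens a a') (mtens b b')
    where "f \ox g" := (mtensm f g);
  assoc : forall a b c, hom (mtens (mtens a b) c) (mtens a (mtens b c));
  assocV : forall a b c, hom (mtens a (mtens b c)) (mtens (mtens a b) c);
  lunit : forall a, hom (mtens munit a) a;
  lunitV : forall a, hom a (mtens munit a);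
  runit : forall a, hom (mtens a munit) a;
  runitV : forall a, hom a (mtens a munit);
  braid : forall a b, hom (mtens a b) (mtens b a);
  comp_idl : forall a b (f : hom a b), idm a ;; f = f;
  comp_idr : forall a b (f : hom a b), f ;; idm b = f;
  comp_assoc : forall a b c e (f : hom a b) (g : hom b c) (h : hom c e),
    f ;; (g ;; h) = f ;; g ;; h;
  tens_id : forall a b, idm a \ox idm b = idm (mtens a b);
  tens_comp : forall a b c a' b' c' (f : hom a b) (g : hom b c)
      (f' : hom a' b') (g' : hom b' c'),
    (f ;; g) \ox (f' ;; g') = (f \ox f') ;; (g \ox g');
  assocK : forall a b c, assoc a b c ;; assocV a b c = idm _;
  assocVK : forall a b c, assocV a b c ;; assoc a b c = idm _;
  lunitK : forall a, lunit a ;; lunitV a = idm _;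
  lunitVK : forall a, lunitV a ;; lunit a = idm _;
  runitK : forall a, runit a ;; runitV a = idm _;
  runitVK : forall a, runitV a ;; runit a = idm _;
  braidK : forall a b, braid a b ;; braid b a = idm _;
  assoc_nat : forall a b a' b' a'' b''
      (f : hom a b) (f' : hom a' b') (f'' : hom a'' b''),
    ((f \ox f') \ox f'') ;; assoc b b' b'' =
    assoc a a' a'' ;; (f \ox (f' \ox f''));
  lunit_nat : forall a b (f : hom a b),
    (idm munit \ox f) ;; lunit b = lunit a ;; f;
  runit_nat : forall a b (f : hom a b),
    (f \ox idm munit) ;; runit b = runit a ;; f;
  braid_nat : forall a b a' b' (f : hom a b) (f' : hom a' b'),
    (f \ox f') ;; braid b b' = braid a a' ;; (f' \ox f);
  triangle : forall a b,
    assoc a munit b ;; (idm a \ox lunit b) = runit a \ox idm b;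
  pentagon : forall a b c e,
    assoc (mtens a b) c e ;; assoc a b (mtens c e) =
    (assoc a b c \ox idm e) ;; assoc a (mtens b c) e ;; (idm a \ox assoc b c e);
  hexagon : forall a b c,
    assoc a b c ;; braid a (mtens b c) ;; assoc b c a =
    (braid a b \ox idm c) ;; assoc b a c ;; (idm b \ox braid a c)
}.

Notation "f ;; g" := (comp f g) : smc_scope.
Notation "f \ox g" := (mtensm f g) : smc_scope.
Arguments idm {s} a.
Arguments assoc {s} a b c.
Arguments assocV {s} a b c.
Arguments lunit {s} a.
Arguments lunitV {s} a.
Arguments runit {s} a.
Arguments runitV {s} a.
Arguments braid {s} a b.
Open Scope smc_scope.

Definition disj (K : choiceType) (V : Type) (f g : {fmap K -> V}) : bool :=
  [disjoint domf f & domf g]%fset.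

Section LabelledCircuits.

Variables (M : smc) (W : Type) (wob : W -> M) (d : Order.disp_t)
  (L : orderType d).

Definition lctx := {fmap L -> W}.

(* Formal tensor products of labelled wires. *)
Inductive texp := TUnit | TWire of L & W | TTens of texp & texp.

Fixpoint interp (t : texp) : M :=
  match t with
  | TUnit => munit M
  | TWire _ a => wob a
  | TTens t u => mtens (interp t) (interp u)
  end.

Fixpoint tensor_of (s : seq (L * W)) : texp :=
  match s with
  | [::] => TUnit
  | [:: w] => TWire w.1 w.2
  | w :: s' => TTens (TWire w.1 w.2) (tensor_of s')
  end.

Definition wires (Q : lctx) : seq (L * W) :=
  pmap (fun l => omap (pair l) Q.[? l]) (sort <=%O (enum_fset (domf Q))).

Definition ctx_tens (Q : lctx) : texp := tensor_of (wires Q).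

Definition ctx_ob (Q : lctx) : M := interp (ctx_tens Q).

(* The category M_L: its objects are the label contexts. *)
Definition mlhom (Q Q' : lctx) : Type := hom (ctx_ob Q) (ctx_ob Q').

Record lcirc := Circuit { src : lctx; tgt : lctx; mor : mlhom src tgt }.

(* [canonical rho t u f]: [f] is built from the structural isomorphisms of M
   and carries each wire labelled [l] of [t] to the wire labelled [rho l] of
   [u].  When the labels within [t], and those within [u], are pairwise
   distinct, there is at most one such [f], by coherence. *)
Inductive canonical :
    (L -> L) -> forall t u : texp, hom (interp t) (interp u) -> Prop :=
| can_wire rho l a : @canonical rho (TWire l a) (TWire (rho l) a) (idm (wob a))
| can_unit rho : @canonical rho TUnit TUnit (idm (munit M))
| can_tens rho t u t' u' f f' :
    @canonical rho t u f -> @canonical rho t' u' f' ->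
    @canonical rho (TTens t t') (TTens u u') (f \ox f')
| can_comp rho rho' t u v f g :
    @canonical rho t u f -> @canonical rho' u v g ->
    @canonical (fun l => rho' (rho l)) t v (f ;; g)
| can_assoc t u v :
    @canonical id (TTens (TTens t u) v) (TTens t (TTens u v)) (assoc _ _ _)
| can_assocV t u v :
    @canonical id (TTens t (TTens u v)) (TTens (TTens t u) v) (assocV _ _ _)
| can_lunit t : @canonical id (TTens TUnit t) t (lunit _)
| can_lunitV t : @canonical id t (TTens TUnit t) (lunitV _)
| can_runit t : @canonical id (TTens t TUnit) t (runit _)
| can_runitV t : @canonical id t (TTens t TUnit) (runitV _)
| can_braid t u : @canonical id (TTens t u) (TTens u t) (braid _ _).

(* [rho] restricts to a wire-type-preserving bijection from the labels of [Q]
   to those of [Q'], and [r] is the symmetry isomorphism that it induces. *)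
Definition renaming (rho : L -> L) (Q Q' : lctx) (r : mlhom Q Q') : Prop :=
  [/\ {in domf Q &, injective rho},
      domf Q' = [fset rho l | l in domf Q],
      (forall l, l \in domf Q -> Q'.[? rho l] = Q.[? l])
    & @canonical rho (ctx_tens Q) (ctx_tens Q') r].

Definition circ_renaming (rho rho' : L -> L) (D D' : lcirc) : Prop :=
  exists (r : mlhom (src D) (src D')) (r' : mlhom (tgt D) (tgt D')),
    [/\ renaming rho r, renaming rho' r' & r ;; mor D' = mor D ;; r'].

Inductive ltuple := LLab of L | LStar | LPair of ltuple & ltuple.

Fixpoint ltuple_map (rho : L -> L) (k : ltuple) : ltuple :=
  match k with
  | LLab l => LLab (rho l)
  | LStar => LStar
  | LPair k1 k2 => LPair (ltuple_map rho k1) (ltuple_map rho k2)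
  end.

Fixpoint ltuple_labels (k : ltuple) : seq L :=
  match k with
  | LLab l => [:: l]
  | LStar => [::]
  | LPair k1 k2 => ltuple_labels k1 ++ ltuple_labels k2
  end.

(* [append C k l D l' C' k'] says that (C', k') is a possible result of
   append(C, k, l, D, l'); the fresh labels are left unspecified.  The outputs
   of C split as the context [src D'] of the outputs named by [k] and the
   context [R] of the others; [s] and [m] are the canonical isomorphisms
   between the union of two disjoint contexts and their tensor product. *)
Inductive append :
    lcirc -> ltuple -> ltuple -> lcirc -> ltuple -> lcirc -> ltuple -> Prop :=
| Append Q0 (R : lctx) (D D' : lcirc) (C : mlhom Q0 (src D' + R))
    (s : hom (ctx_ob (src D' + R)) (mtens (ctx_ob (src D')) (ctx_ob R)))
    (m : hom (mtens (ctx_ob (tgt D')) (ctx_ob R)) (ctx_ob (tgt D' + R)))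
    (k l l' k' : ltuple) (rho rho' : L -> L) :
    circ_renaming rho rho' D D' ->
    k = ltuple_map rho l ->
    k' = ltuple_map rho' l' ->
    uniq (ltuple_labels k) ->
    domf (src D') =i ltuple_labels k ->
    disj (src D') R ->
    disj (tgt D') (src D' + R) ->
    all (fun x => x \notin domf (src D' + R)) (ltuple_labels k') ->
    @canonical id (ctx_tens (src D' + R))
      (TTens (ctx_tens (src D')) (ctx_tens R)) s ->
    @canonical id (TTens (ctx_tens (tgt D')) (ctx_tens R))
      (ctx_tens (tgt D' + R)) m ->
    append (Circuit C) k l D l'
      (@Circuit Q0 (tgt D' + R) (C ;; s ;; (mor D' \ox idm (ctx_ob R)) ;; m)) k'.

End LabelledCircuits.

Arguments LStar {d L}.

Section Types.

Variable W : Type.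

(* Simple M-types. *)
Inductive mty := MWire of W | MUnit | MTens of mty & mty.

Inductive ty :=
| TyWire of W
| TyZero
| TySum of ty & ty
| TyUnit
| TyTens of ty & ty
| TyLolli of ty & ty
| TyBang of ty
| TyNat
| TyList of ty
| TyCirc of mty & mty.

Fixpoint ty_of_mty (T : mty) : ty :=
  match T with
  | MWire a => TyWire a
  | MUnit => TyUnit
  | MTens T U => TyTens (ty_of_mty T) (ty_of_mty U)
  end.

Fixpoint is_param (A : ty) : bool :=
  match A with
  | TyZero | TyUnit | TyBang _ | TyNat | TyCirc _ _ => true
  | TySum A B | TyTens A B => is_param A && is_param B
  | TyList A => is_param A
  | TyWire _ | TyLolli _ _ => false
  end.

(* Variable contexts: terms are in de Bruijn notation, so variables are
   natural numbers. *)
Definition vctx := {fmap nat -> ty}.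

Definition param_ctx (Phi : vctx) : Prop :=
  forall i A, Phi.[? i] = Some A -> is_param A.

(* [bind G A] extends [G] with a new variable 0 of type [A], shifting the
   variables of [G] by one; see [fnd_bind] (the default [A] is never used). *)
Definition bind (G : vctx) (A : ty) : vctx :=
  [fmap i : 0 |` [fset j.+1 | j in domf G] =>
    if val i is j.+1 then odflt A G.[? j] else A].

Lemma fnd_bind G A i :
  (bind G A).[? i] = if i is j.+1 then G.[? j] else Some A.
Proof.
have [h|h] := fndP (bind G A) i.
  rewrite ffunE /=; case: i h => [|j] //.
  rewrite in_fsetU in_fset1 /= => /imfsetP[j' /= j'G [->]].
  by rewrite (in_fnd j'G).
case: i h => [|j]; rewrite in_fsetU in_fset1 //= => h.
by rewrite not_fnd //; apply: contra h => jG; apply/imfsetP; exists j.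
Qed.

End Types.

Arguments MUnit {W}.
Arguments TyZero {W}.
Arguments TyUnit {W}.
Arguments TyNat {W}.
Coercion ty_of_mty : mty >-> ty.

Section ProtoQuipperM.

Variables (M : smc) (W : Type) (wob : W -> M) (d : Order.disp_t)
  (L : orderType d) (K : Type) (cty : K -> ty W).

Notation lctx := (lctx W L).
Notation lcirc := (lcirc wob L).

(* Terms up to alpha-equivalence, in de Bruijn notation.  [Let M N], [Lam A M]
   and both branches of [Case M N P] bind index 0; in [LetPair M N], standing
   for "let <x,y> = M in N", x is index 1 and y is index 0 of N. *)
Inductive tm :=
| Var of nat
| Lab of L
| Cst of K
| Let of tm & tm
| Abort of ty W & tm
| InL of ty W & ty W & tm
| InR of ty W & ty W & tm
| Case of tm & tm & tm
| Star
| Seq of tm & tm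
| Pair of tm & tm
| LetPair of tm & tm
| Lam of ty W & tm
| App of tm & tm
| Lift of tm
| Force of tm
| Box of mty W & tm
| Apply of tm & tm
| Boxed of ltuple L & lcirc & ltuple L.

Fixpoint tm_of_ltuple (k : ltuple L) : tm :=
  match k with
  | LLab l => Lab l
  | LStar => Star
  | LPair k1 k2 => Pair (tm_of_ltuple k1) (tm_of_ltuple k2)
  end.

Fixpoint is_value (t : tm) : bool :=
  match t with
  | Var _ | Lab _ | Cst _ | Star | Lam _ _ | Lift _ | Boxed _ _ _ => true
  | InL _ _ V | InR _ _ V => is_value V
  | Pair V V' => is_value V && is_value V'
  | _ => false
  end.

(* All labels that occur in a term, including those inside boxed circuits. *)
Fixpoint tm_labels (t : tm) : {fset L} :=
  match t with
  | Var _ | Cst _ | Star => fset0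
  | Lab l => [fset l]
  | Abort _ N | InL _ _ N | InR _ _ N | Lam _ N | Lift N | Force N | Box _ N =>
      tm_labels N
  | Let N P | Seq N P | Pair N P | LetPair N P | App N P | Apply N P =>
      tm_labels N `|` tm_labels P
  | Case N P P' => tm_labels N `|` tm_labels P `|` tm_labels P'
  | Boxed k D k' =>
      seq_fset tt (ltuple_labels k) `|` domf (src D) `|`
      domf (tgt D) `|` seq_fset tt (ltuple_labels k')
  end.

Definition up (r : nat -> nat) (i : nat) : nat :=
  if i is j.+1 then (r j).+1 else 0.

Fixpoint rename (r : nat -> nat) (t : tm) : tm :=
  match t with
  | Var i => Var (r i)
  | Lab l => Lab l
  | Cst c => Cst c
  | Let N P => Let (rename r N) (rename (up r) P)
  | Abort A N => Abort A (rename r N)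
  | InL A B N => InL A B (rename r N)
  | InR A B N => InR A B (rename r N)
  | Case N P P' => Case (rename r N) (rename (up r) P) (rename (up r) P')
  | Star => Star
  | Seq N P => Seq (rename r N) (rename r P)
  | Pair N P => Pair (rename r N) (rename r P)
  | LetPair N P => LetPair (rename r N) (rename (up (up r)) P)
  | Lam A N => Lam A (rename (up r) N)
  | App N P => App (rename r N) (rename r P)
  | Lift N => Lift (rename r N)
  | Force N => Force (rename r N)
  | Box T N => Box T (rename r N)
  | Apply N P => Apply (rename r N) (rename r P)
  | Boxed k D k' => Boxed k D k'
  end.

Definition ups (s : nat -> tm) (i : nat) : tm :=
  if i is j.+1 then rename succn (s j) else Var 0.

Fixpoint subst (s : nat -> tm) (t : tm) : tm :=
  match t with
  | Var i => s i
  | Lab l => Lab l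
  | Cst c => Cst c
  | Let N P => Let (subst s N) (subst (ups s) P)
  | Abort A N => Abort A (subst s N)
  | InL A B N => InL A B (subst s N)
  | InR A B N => InR A B (subst s N)
  | Case N P P' => Case (subst s N) (subst (ups s) P) (subst (ups s) P')
  | Star => Star
  | Seq N P => Seq (subst s N) (subst s P)
  | Pair N P => Pair (subst s N) (subst s P)
  | LetPair N P => LetPair (subst s N) (subst (ups (ups s)) P)
  | Lam A N => Lam A (subst (ups s) N)
  | App N P => App (subst s N) (subst s P)
  | Lift N => Lift (subst s N)
  | Force N => Force (subst s N)
  | Box T N => Box T (subst s N)
  | Apply N P => Apply (subst s N) (subst s P)
  | Boxed k D k' => Boxed k D k'
  end.

Definition scons (V : tm) (s : nat -> tm) (i : nat) : tm :=
  if i is j.+1 then s j else V.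

Definition subst1 (N V : tm) : tm := subst (scons V Var) N.

(* N[V1/x, V2/y], where x is index 1 and y is index 0 of N. *)
Definition subst2 (N V1 V2 : tm) : tm := subst (scons V2 (scons V1 Var)) N.

(* The side conditions of the context "Phi, G1, G2". *)
Definition splits (Phi G1 G2 : vctx W) : Prop :=
  [/\ param_ctx Phi, disj Phi G1, disj Phi G2 & disj G1 G2].

Inductive typed : vctx W -> lctx -> tm -> ty W -> Prop :=
| ty_var Phi i A :
    param_ctx Phi -> i \notin domf Phi ->
    typed Phi.[i <- A] [fmap] (Var i) A
| ty_lab Phi l a :
    param_ctx Phi -> typed Phi [fmap].[l <- a] (Lab l) (TyWire a)
| ty_cst Phi c :
    param_ctx Phi -> typed Phi [fmap] (Cst c) (cty c)
| ty_star Phi :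
    param_ctx Phi -> typed Phi [fmap] Star TyUnit
| ty_let Phi G1 G2 Q1 Q2 N P A B :
    splits Phi G1 G2 -> disj Q1 Q2 ->
    typed (Phi + G1) Q1 N A ->
    typed (bind (Phi + G2) A) Q2 P B ->
    typed (Phi + G1 + G2) (Q1 + Q2) (Let N P) B
| ty_abort G Q N A :
    typed G Q N TyZero -> typed G Q (Abort A N) A
| ty_inl G Q N A B :
    typed G Q N A -> typed G Q (InL A B N) (TySum A B)
| ty_inr G Q N A B :
    typed G Q N B -> typed G Q (InR A B N) (TySum A B)
| ty_case Phi G1 G2 Q1 Q2 N P P' A B D :
    splits Phi G1 G2 -> disj Q1 Q2 ->
    typed (Phi + G1) Q1 N (TySum A B) ->
    typed (bind (Phi + G2) A) Q2 P D ->
    typed (bind (Phi + G2) B) Q2 P' D ->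
    typed (Phi + G1 + G2) (Q1 + Q2) (Case N P P') D
| ty_seq Phi G1 G2 Q1 Q2 N P A :
    splits Phi G1 G2 -> disj Q1 Q2 ->
    typed (Phi + G1) Q1 N TyUnit ->
    typed (Phi + G2) Q2 P A ->
    typed (Phi + G1 + G2) (Q1 + Q2) (Seq N P) A
| ty_pair Phi G1 G2 Q1 Q2 N P A B :
    splits Phi G1 G2 -> disj Q1 Q2 ->
    typed (Phi + G1) Q1 N A ->
    typed (Phi + G2) Q2 P B ->
    typed (Phi + G1 + G2) (Q1 + Q2) (Pair N P) (TyTens A B)
| ty_letpair Phi G1 G2 Q1 Q2 N P A B D :
    splits Phi G1 G2 -> disj Q1 Q2 ->
    typed (Phi + G1) Q1 N (TyTens A B) ->
    typed (bind (bind (Phi + G2) A) B) Q2 P D ->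
    typed (Phi + G1 + G2) (Q1 + Q2) (LetPair N P) D
| ty_lam G Q N A B :
    typed (bind G A) Q N B -> typed G Q (Lam A N) (TyLolli A B)
| ty_app Phi G1 G2 Q1 Q2 N P A B :
    splits Phi G1 G2 -> disj Q1 Q2 ->
    typed (Phi + G1) Q1 N (TyLolli A B) ->
    typed (Phi + G2) Q2 P A ->
    typed (Phi + G1 + G2) (Q1 + Q2) (App N P) B
| ty_lift Phi N A :
    param_ctx Phi ->
    typed Phi [fmap] N A -> typed Phi [fmap] (Lift N) (TyBang A)
| ty_force G Q N A :
    typed G Q N (TyBang A) -> typed G Q (Force N) A
| ty_box G Q N (T U : mty W) :
    typed G Q N (TyBang (TyLolli T U)) -> typed G Q (Box T N) (TyCirc T U)
| ty_apply Phi G1 G2 Q1 Q2 N P (T U : mty W) :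
    splits Phi G1 G2 -> disj Q1 Q2 ->
    typed (Phi + G1) Q1 N (TyCirc T U) ->
    typed (Phi + G2) Q2 P T ->
    typed (Phi + G1 + G2) (Q1 + Q2) (Apply N P) U
| ty_boxed Phi k (C : lcirc) k' (T U : mty W) :
    param_ctx Phi ->
    typed [fmap] (src C) (tm_of_ltuple k) T ->
    typed [fmap] (tgt C) (tm_of_ltuple k') U ->
    typed Phi [fmap] (Boxed k C k') (TyCirc T U).

Definition config : Type := (lcirc * tm)%type.

Definition typed_config (Q : lctx) (c : config) (A : ty W) (Q' : lctx) : Prop :=
  exists Q'' : lctx,
    [/\ disj Q'' Q', src c.1 = Q, tgt c.1 = Q'' + Q' & typed [fmap] Q'' c.2 A].

(* [freshlabels N T Q k]: (Q, k) is a possible value of freshlabels(T) with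
   labels that do not occur in [N]. *)
Definition freshlabels (N : tm) (T : mty W) (Q : lctx) (k : ltuple L) : Prop :=
  typed [fmap] Q (tm_of_ltuple k) T /\ [disjoint domf Q & tm_labels N]%fset.

Definition id_circ (Q : lctx) : lcirc :=
  @Circuit M W wob d L Q Q (idm (ctx_ob wob Q)).

(* Evaluation to a value; the outcome Error is not a value configuration and
   has no rules here. *)
Inductive eval : config -> config -> Prop :=
| ev_lab C l : eval (C, Lab l) (C, Lab l)
| ev_cst C c : eval (C, Cst c) (C, Cst c)
| ev_star C : eval (C, Star) (C, Star)
| ev_lam C A N : eval (C, Lam A N) (C, Lam A N)
| ev_lift C N : eval (C, Lift N) (C, Lift N)
| ev_boxed C k D k' : eval (C, Boxed k D k') (C, Boxed k D k')
| ev_let C C' C'' N P V V' :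
    eval (C, N) (C', V) -> eval (C', subst1 P V) (C'', V') ->
    eval (C, Let N P) (C'', V')
| ev_inl C C' A B N V :
    eval (C, N) (C', V) -> eval (C, InL A B N) (C', InL A B V)
| ev_inr C C' A B N V :
    eval (C, N) (C', V) -> eval (C, InR A B N) (C', InR A B V)
| ev_case_l C C' C'' A B N P P' V V' :
    eval (C, N) (C', InL A B V) -> eval (C', subst1 P V) (C'', V') ->
    eval (C, Case N P P') (C'', V')
| ev_case_r C C' C'' A B N P P' V V' :
    eval (C, N) (C', InR A B V) -> eval (C', subst1 P' V) (C'', V') ->
    eval (C, Case N P P') (C'', V')
| ev_seq C C' C'' N P V' :
    eval (C, N) (C', Star) -> eval (C', P) (C'', V') ->
    eval (C, Seq N P) (C'', V')
| ev_pair C C' C'' N P V V' :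
    eval (C, N) (C', V) -> eval (C', P) (C'', V') ->
    eval (C, Pair N P) (C'', Pair V V')
| ev_letpair C C' C'' N P V1 V2 V' :
    eval (C, N) (C', Pair V1 V2) -> eval (C', subst2 P V1 V2) (C'', V') ->
    eval (C, LetPair N P) (C'', V')
| ev_app C C' C'' C''' N P A N' V V' :
    eval (C, N) (C', Lam A N') -> eval (C', P) (C'', V) ->
    eval (C'', subst1 N' V) (C''', V') ->
    eval (C, App N P) (C''', V')
| ev_force C C' C'' N N' V :
    eval (C, N) (C', Lift N') -> eval (C', N') (C'', V) ->
    eval (C, Force N) (C'', V)
| ev_box C C' D T N N' Q k k' :
    eval (C, N) (C', Lift N') -> freshlabels N' T Q k ->
    eval (id_circ Q, App N' (tm_of_ltuple k)) (D, tm_of_ltuple k') ->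
    eval (C, Box T N) (C', Boxed k D k')
| ev_apply C C' C'' C''' N P k l D l' k' :
    eval (C, N) (C', Boxed l D l') -> eval (C', P) (C'', tm_of_ltuple k) ->
    append C'' k l D l' C''' k' ->
    eval (C, Apply N P) (C''', tm_of_ltuple k').

Lemma is_value_ltuple k : is_value (tm_of_ltuple k).
Proof. by elim: k => //= k1 -> k2. Qed.

Lemma eval_value c c' : eval c c' -> is_value c'.2.
Proof.
by elim=> {c c'} //= [? ? ? ? ? ? ? _ -> _ -> //|*]; apply: is_value_ltuple.
Qed.

End ProtoQuipperM.

(* Main.v *)
(** Induction on the evaluation, uniformly in the frame [Q'] of unused outputs:
    while one subterm is evaluated, the labels owned by the other subterms are
    moved into the frame.  Binding steps use a substitution lemma, which rests
    on two facts about a closed value: it may be weakened to any parameter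
    context, and if its type is a parameter type then it owns no labels, so it
    may be duplicated or discarded.  For [apply], the typing of a label tuple
    determines its label context, so the two splittings of the outputs of the
    circuit (the one given by [append] and the one given by typing) coincide. *)

Require Import Defs.
From mathcomp Require Import all_boot all_order finmap.

Set Implicit Arguments.
Unset Strict Implicit.
Unset Printing Implicit Defensive.

(** * Lookup and disjointness in finite maps *)

Section FiniteMaps.

Variables (K : choiceType) (V : Type).
Implicit Types f g h : {fmap K -> V}.

Lemma fnd_catr f g k :
  (f + g).[? k] = if g.[? k] is Some x then Some x else f.[? k].
Proof. by rewrite fnd_cat; case: fndP. Qed.

Lemma fnd_eq f g k : f = g -> f.[? k] = g.[? k].
Proof. by move->. Qed.

Lemma fnd_domP f k : reflect (f.[? k] <> None) (k \in domf f).
Proof. by case: fndP => h; constructor. Qed.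

Lemma notin_fnd f k : k \notin domf f -> f.[? k] = None.
Proof. exact: not_fnd. Qed.

Lemma disjP f g :
  reflect (forall k, f.[? k] = None \/ g.[? k] = None) (disj f g).
Proof.
apply: (iffP (@fdisjointP _ _ _)) => [h k|h k kf].
  case: (fndP f k) => kf; last by left.
  by right; rewrite not_fnd // h.
apply/fnd_domP => kg; case: (h k) => // fk.
by move/fnd_domP: kf.
Qed.

End FiniteMaps.

Ltac fmap_destruct :=
  repeat match goal with
  | H : context [match ?x with _ => _ end] |- _ => destruct x eqn:?
  | |- context [match ?x with _ => _ end] => destruct x eqn:?
  end.

(** Equations and disjointness between unions of finite maps hold pointwise: the hypotheses and the
    goal are all read at one key, and the possible lookups there are enumerated. *)
Ltac fmap_tac :=
  repeat match goal with H : is_true (disj _ _) |- _ => move/disjP in H end;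
  try (apply/fmapP) ; try (apply/disjP);
  let k := fresh "k" in intros k;
  repeat match goal with
  | H : forall k, _ \/ _ |- _ => specialize (H k)
  | H : _ = _ |- _ => apply (@fnd_eq _ _ _ _ k) in H
  end;
  repeat (rewrite -> ?fnd_catr, ?fnd_fmap0 in * );
  fmap_destruct;
  intuition (first [congruence | left; congruence | right; congruence]).

(** * Splitting of variable contexts *)

Section VariableContexts.

Variable W : Type.
Implicit Types (A B : ty W) (G Phi : vctx W).

Lemma param_ctx0 : param_ctx ([fmap] : vctx W).
Proof. by move=> i A; rewrite fnd_fmap0. Qed.

Lemma splits0 : splits [fmap] [fmap] ([fmap] : vctx W).
Proof. by split; [apply: param_ctx0 | fmap_tac | fmap_tac | fmap_tac]. Qed.

Lemma catf2_eq0 Phi G1 G2 :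
  Phi + G1 + G2 = [fmap] -> Phi + G1 = [fmap] /\ Phi + G2 = [fmap].
Proof. by move=> e; split; fmap_tac. Qed.

(* [splits] without naming the shared context: the common part of [G1] and [G2]. *)
Definition vsplit G G1 G2 :=
  forall i, match G1.[? i], G2.[? i] with
  | None, x => G.[? i] = x
  | Some A, None => G.[? i] = Some A
  | Some A, Some B => [/\ G.[? i] = Some A, A = B & is_param A]
  end.

Lemma splits_vsplit Phi G1 G2 :
  splits Phi G1 G2 -> vsplit (Phi + G1 + G2) (Phi + G1) (Phi + G2).
Proof.
move=> [pPhi /disjP d1 /disjP d2 /disjP d3] i; rewrite !fnd_catr.
have := pPhi i; have := (d1 i, d2 i, d3 i).
case: (Phi.[? i]) => [A|]; case: (G1.[? i]) => [A1|];
  case: (G2.[? i]) => [A2|] //=; try by case=> [[[?|?] [?|?]] [?|?]].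
by move=> _ /(_ A erefl) ?; split.
Qed.

Lemma vsplit_splits G G1 G2 :
  vsplit G G1 G2 ->
  exists Phi D1 D2, [/\ splits Phi D1 D2, G = Phi + D1 + D2,
    G1 = Phi + D1 & G2 = Phi + D2].
Proof.
(* The shared context is the overlap of [G1] and [G2], where [vsplit] makes the types agree and be
   parameter types; each private part is what lies outside the other context. *)
move=> h; exists G1.[& domf G2], G1.[\ domf G2], G2.[\ domf G1].
have m (f : vctx W) i : (i \in domf f) = (f.[? i] : bool) by case: fndP.
split; last 3 first.
- apply/fmapP => i; move: (h i); rewrite !(fnd_catr, fnd_rem, fnd_restrict) !m.
  by case: (G1.[? i]) => [A|]; case: (G2.[? i]) => [B|] // [-> <-].
- apply/fmapP => i; move: (h i); rewrite !(fnd_catr, fnd_rem, fnd_restrict) !m.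
  by case: (G1.[? i]) => [A|]; case: (G2.[? i]) => [B|] // [-> <-].
- apply/fmapP => i; move: (h i); rewrite !(fnd_catr, fnd_rem, fnd_restrict) !m.
  by case: (G1.[? i]) => [A|]; case: (G2.[? i]) => [B|] // [_ ->].
split; try (apply/disjP => i; rewrite !(fnd_rem, fnd_restrict) !m;
  by case: (G1.[? i]); case: (G2.[? i]); auto).
move=> i A; move: (h i); rewrite fnd_restrict m.
by case: (G1.[? i]) => [B|]; case: (G2.[? i]) => [B'|] // [_ _ ?] [<-].
Qed.

End VariableContexts.

Section SubjectReduction.

Variables (M : smc) (W : Type) (wob : W -> M) (d : Order.disp_t)
  (L : orderType d) (K : Type) (cty : K -> ty W).

Notation lctx := (lctx W L).
Notation lcirc := (lcirc wob L).
Notation tm := (tm wob L K).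
Notation typed := (typed (wob := wob) (L := L) cty).
Implicit Types (A B : ty W) (G Phi : vctx W) (Q : lctx) (t V N P : tm)
  (s : nat -> tm).

(** * Closed terms and the labels owned by values *)

Lemma rename_subst r s t :
  (forall i, s i = Var _ _ _ (r i)) -> rename r t = subst s t.
Proof.
have up_ups r' s' : (forall i, s' i = Var wob L K (r' i)) ->
    forall i, ups s' i = Var _ _ _ (up r' i).
  by move=> h [|i] //=; rewrite h.
elim: t r s => //= *; f_equal; eauto.
Qed.

(** The free variables of a typed term lie in its context, so the values of [s] elsewhere are
    irrelevant. On a closed term every substitution is the identity. *)
Lemma typed_subst_id G Q t A s : typed G Q t A ->
  (forall i, G.[? i] = None \/ s i = Var _ _ _ i) -> subst s t = t.
Proof.
have idl Phi G1 G2 s' : splits Phi G1 G2 ->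
    (forall i, (Phi + G1 + G2).[? i] = None \/ s' i = Var wob L K i) ->
    forall i, (Phi + G1).[? i] = None \/ s' i = Var _ _ _ i.
  move=> _ h i; case: (h i); last by right.
  by rewrite !fnd_catr; fmap_destruct; auto.
have idr Phi G1 G2 s' : splits Phi G1 G2 ->
    (forall i, (Phi + G1 + G2).[? i] = None \/ s' i = Var wob L K i) ->
    forall i, (Phi + G2).[? i] = None \/ s' i = Var _ _ _ i.
  move=> _ h i; case: (h i); last by right.
  by rewrite !fnd_catr; fmap_destruct; auto.
have idb G' B s' : (forall i, G'.[? i] = None \/ s' i = Var wob L K i) ->
    forall i, (bind G' B).[? i] = None \/ ups s' i = Var _ _ _ i.
  move=> h [|i]; first by right.
  by rewrite fnd_bind /=; case: (h i) => ->; auto.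
move=> tt; elim: tt s; intros; cbn [subst]; try by f_equal; eauto 6.
by case: (H1 i) => //; rewrite fnd_set eqxx.
Qed.

Lemma closed_rename Q t A r : typed [fmap] Q t A -> rename r t = t.
Proof.
move=> tt; rewrite (@rename_subst r (fun i => Var _ _ _ (r i))) //.
by apply: (typed_subst_id tt) => i; left; rewrite fnd_fmap0.
Qed.

(** Among values, only labels and abstractions introduce ownership of labels, and neither wire types
    nor function types are parameter types. Injections and pairs follow by induction; the other
    values are typed with no labels. *)
Lemma value_param_labels G Q V A :
  typed G Q V A -> is_value V -> G = [fmap] -> is_param A -> Q = [fmap].
Proof.
elim=> //.
- by move=> ? ? ? ? ? _ h v e /andP[? ?]; apply: h.
- by move=> ? ? ? ? ? _ h v e /andP[? ?]; apply: h.
move=> Phi G1 G2 Q1 Q2 N P B B' _ _ _ h1 _ h2 /andP[v1 v2] /catf2_eq0[e1 e2].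
by move=> /andP[p1 p2]; rewrite h1 // h2 // catf0.
Qed.

(** * Typed substitutions and the substitution lemma *)

(* [subst_typed G s G' Q]: the substitution [s] sends the variables of [G] to
   terms over [G'] that together use up the labels [Q].  It is a renaming of
   some of the variables, with partial inverse [p], and maps the others to
   closed values. *)
Inductive subst_typed : vctx W -> (nat -> tm) -> vctx W -> lctx -> Prop :=
| subst_var p G s G' :
    (forall i A, G.[? i] = Some A -> exists j, p j = Some i) ->
    (forall i j, p j = Some i -> s i = Var _ _ _ j) ->
    (forall j, if p j is Some i then G'.[? j] = G.[? i]
               else forall A, G'.[? j] = Some A -> is_param A) ->
    subst_typed G s G' [fmap]
| subst_closed G s G' Q q i A :
    subst_typed G s G' Q -> G.[? i] = None ->
    rename succn (s i) = s i ->
    (forall Phi, param_ctx Phi -> typed Phi q (s i) A) ->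
    (is_param A -> q = [fmap]) ->
    disj Q q ->
    subst_typed G.[i <- A] s G' (Q + q).

(** Each closed value substituted here has a parameter type, hence owns no labels. This serves the
    rules that demand a parameter context and own no labels from outside it, [lift] in
    particular. *)
Lemma subst_typed_param G s G' Q :
  subst_typed G s G' Q -> param_ctx G -> param_ctx G' /\ Q = [fmap].
Proof.
elim=> {G s G' Q} [p G s G' _ _ h pG|G s G' Q q i A _ IH Gi _ _ pq _ pG].
  split=> // j A; case: (p j) (h j) => [i ->|]; last exact.
  exact: pG.
have pA : is_param A by apply: (pG i A); rewrite fnd_set eqxx.
have [j B Gj|pG' ->] := IH; last by rewrite pq // catf0.
by apply: (pG j B); rewrite fnd_set; case: eqP Gj => // ->; rewrite Gi.
Qed.

(** The variable case of the substitution lemma. All variables except [i] have parameter types, so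
    their values own no labels; if [s i] is itself a closed value, it is weakened to [G']. *)
Lemma subst_typed_var G s G' Q i A :
  subst_typed G s G' Q -> G.[? i] = Some A ->
  (forall j B, j != i -> G.[? j] = Some B -> is_param B) ->
  typed G' Q (s i) A.
Proof.
move=> h; elim: h i A => {G s G' Q}.
  move=> p G s G' h1 h2 h3 i A Gi pG.
  have [j pj] := h1 i A Gi; rewrite (h2 _ _ pj).
  have := h3 j; rewrite pj Gi => G'j.
  have -> : G' = G'.[~ j].[j <- A].
    apply/fmapP => k; rewrite fnd_set fnd_rem1; case: eqP => [->|] //.
  apply: ty_var; last by rewrite mem_remf1 eqxx.
  move=> k B; rewrite fnd_rem1; case: eqP => //= kj.
  case pk: (p k) (h3 k) => [i'|]; last exact.
  (* If [k] were also sent to [i] by [p], then [s i] would be both [Var k] and [Var j], forcing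
     [k = j]. *)
  move=> -> /pG; apply; apply/eqP => ei; case: kj.
  by move: (h2 _ _ pk) (h2 _ _ pj); rewrite ei => -> [].
move=> G s G' Q q i A hs IH Gi ri ti pq dq i' A'.
rewrite fnd_set; case: eqP => [-> [<-] pG|ne Gi' pG].
  have [j B Gj|pG' ->] := subst_typed_param hs; last by rewrite cat0f; apply: ti.
  apply: (pG j B); last by rewrite fnd_set; case: eqP Gj => // ->; rewrite Gi.
  by apply/eqP => e; move: Gj; rewrite e Gi.
rewrite pq ?catf0.
  apply: IH => // j B ji Gj; apply: (pG j B) => //.
  by rewrite fnd_set; case: eqP Gj => // ->; rewrite Gi.
by apply: (pG i); [apply/eqP; auto | rewrite fnd_set eqxx].
Qed.

(** Under a binder the partial inverse is shifted and sends 0 to 0, while the closed values stay the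
    same because shifting fixes them. *)
Lemma subst_typed_bind G s G' Q A :
  subst_typed G s G' Q -> subst_typed (bind G A) (ups s) (bind G' A) Q.
Proof.
elim=> {G s G' Q} [p G s G' h1 h2 h3|G s G' Q q i B _ IH Gi ri ti pq dq].
  apply: (@subst_var (fun j => if j is j'.+1 then omap succn (p j') else Some 0)).
  - move=> [|i] B; first by exists 0.
    by rewrite fnd_bind => /h1[j pj]; exists j.+1; rewrite pj.
  - move=> i [[<-]|j] //=; case pj: (p j) => [i'|] //= [<-] /=.
    by rewrite (h2 _ _ pj).
  - move=> [|j]; first by rewrite !fnd_bind.
    by move: (h3 j); case: (p j) => [i|] /=; rewrite ?fnd_bind.
have -> : bind G.[i <- B] A = (bind G A).[i.+1 <- B].
  by apply/fmapP => -[|j]; rewrite ?(fnd_bind, fnd_set) // eqSS.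
apply: subst_closed => //=; rewrite ?ri ?fnd_bind //.
Qed.

(** Each substituted value, with its labels, follows its variable into [G1] or [G2]. Values of
    shared variables own no labels and can go to both sides. *)
Lemma subst_typed_vsplit G s G' Q G1 G2 :
  subst_typed G s G' Q -> vsplit G G1 G2 ->
  exists G1' G2' Q1 Q2, [/\ vsplit G' G1' G2', disj Q1 Q2, Q = Q1 + Q2,
    subst_typed G1 s G1' Q1 & subst_typed G2 s G2' Q2].
Proof.
move=> h; elim: h G1 G2 => {G s G' Q}.
  move=> p G s G' h1 h2 h3 G1 G2 hG.
  (* A target variable goes where its preimage goes; one without preimage has a parameter type and
     is kept on both sides. *)
  pose res (H : vctx W) := filterf G' (fun j => if p j is Some i then isSome H.[? i] else true).
  have sub (H : vctx W) : (forall i A, H.[? i] = Some A -> G.[? i] = Some A) ->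
      subst_typed H s (res H) [fmap].
    move=> hH; apply: (subst_var (p := p)) => //.
      by move=> i A /hH /h1.
    move=> j; rewrite /res fnd_filterf; move: (h3 j); case: (p j) => // i ->.
    by case Hi: (H.[? i]) => [A|] //; rewrite (hH _ _ Hi).
  exists (res G1), (res G2), [fmap], [fmap]; split.
  - move=> j; rewrite !fnd_filterf; move: (h3 j); case: (p j) => [i e|].
      move: (hG i); rewrite -e.
      by case: (G1.[? i]) => [A|]; case: (G2.[? i]) => [B|] //= => [[-> _ ?]|->].
    by case: (G'.[? j]) => [A|] // /(_ A erefl).
  - by fmap_tac.
  - by rewrite catf0.
  - apply: sub => i A; move: (hG i); case: (G1.[? i]) => [?|] //.
    by case: (G2.[? i]) => [B|]; [case=> -> | move=> ->].
  - apply: sub => i A; move: (hG i).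
    case: (G1.[? i]) => [?|]; last by move->.
    by case: (G2.[? i]) => [B|] //; case=> -> ->.
move=> G s G' Q q i A _ IH Gi ri ti pq dq G1 G2 hG.
(* The induction hypothesis splits the context without [i]; [skip] and [keep] then treat a side that
   lacks [i] and a side that contains it. *)
have sp : vsplit G G1.[~ i] G2.[~ i].
  move=> j; move: (hG j); rewrite !fnd_rem1 fnd_set.
  by case: eqP => //= ->; rewrite Gi.
have [G1' [G2' [Q1 [Q2 [sG dQ eQ s1 s2]]]]] := IH _ _ sp.
have skip (H H' : vctx W) Qh : subst_typed H.[~ i] s H' Qh -> H.[? i] = None ->
    subst_typed H s H' Qh.
  move=> sH Hi; suff <- : H.[~ i] = H by [].
  by apply/fmapP => j; rewrite fnd_rem1; case: eqP => // ->.
have keep (H H' : vctx W) Qh : subst_typed H.[~ i] s H' Qh -> H.[? i] = Some A ->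
    disj Qh q -> subst_typed H s H' (Qh + q).
  move=> sH Hi dh.
  suff -> : H = H.[~ i].[i <- A].
    by apply: subst_closed => //; rewrite fnd_rem1 eqxx.
  by apply/fmapP => j; rewrite fnd_set fnd_rem1; case: eqP => // ->.
exists G1', G2'; move: (hG i); rewrite fnd_set eqxx.
case G1i: (G1.[? i]) => [A1|]; case G2i: (G2.[? i]) => [A2|] //=.
(* [i] is shared, so [A] is a parameter type, [q] is empty, and the value may be duplicated. *)
- move=> [[eA] eA' /[!eA'] pA]; subst A1 A2.
  have q0 : q = [fmap] by rewrite pq.
  exists (Q1 + q), (Q2 + q); split=> //; rewrite ?q0 ?catf0 //.
  + by rewrite -[Q1]catf0 -q0; apply: keep => //; rewrite q0; fmap_tac.
  + by rewrite -[Q2]catf0 -q0; apply: keep => //; rewrite q0; fmap_tac.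
- move=> [eA]; subst A1 Q.
  exists (Q1 + q), Q2; split=> //; try by fmap_tac.
  + by apply: keep => //; fmap_tac.
  + exact: skip.
move=> [eA]; subst A2 Q.
exists Q1, (Q2 + q); split=> //; try by fmap_tac.
- exact: skip.
- by apply: keep => //; fmap_tac.
Qed.

(** The form used by every typing rule that splits its context: the labels of the substituted values
    are distributed over the two parts, next to the labels already owned there. *)
Lemma subst_typed_splits Phi G1 G2 s G' Q' Q1 Q2 :
  splits Phi G1 G2 -> disj Q1 Q2 -> disj (Q1 + Q2) Q' ->
  subst_typed (Phi + G1 + G2) s G' Q' ->
  exists Phi' D1 D2 Q1' Q2',
    [/\ splits Phi' D1 D2 /\ G' = Phi' + D1 + D2,
        disj (Q1 + Q1') (Q2 + Q2') /\
          Q1 + Q2 + Q' = (Q1 + Q1') + (Q2 + Q2'),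
        disj Q1 Q1' /\ disj Q2 Q2',
        subst_typed (Phi + G1) s (Phi' + D1) Q1'
      & subst_typed (Phi + G2) s (Phi' + D2) Q2'].
Proof.
move=> sp d12 dQ' /subst_typed_vsplit /(_ (splits_vsplit sp)).
move=> [G1' [G2' [Q1' [Q2' [/vsplit_splits sG dQ eQ s1 s2]]]]].
move: sG s1 s2 => [Phi' [D1 [D2 [sp' -> -> ->]]]] s1 s2; subst Q'.
exists Phi', D1, D2, Q1', Q2'; do !split=> //; fmap_tac.
Qed.

(** Induction on the typing derivation, for all [s] at once, so that [s] can be split between
    premises and lifted under binders. Since [subst_typed] includes renamings, weakening is a
    special case. *)
Lemma typed_subst G Q t A s G' Q' :
  typed G Q t A -> subst_typed G s G' Q' -> disj Q Q' ->
  typed G' (Q + Q') (subst s t) A.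
Proof.
move=> tt; elim: tt s G' Q' => {G Q t A}.
- move=> Phi i A pPhi iPhi s G' Q' h _; rewrite cat0f.
  apply: (subst_typed_var h); first by rewrite fnd_set eqxx.
  by move=> j B /negPf ji; rewrite fnd_set ji => /pPhi.
- by move=> Phi l a pPhi s G' Q' /subst_typed_param[] // ? -> _;
    rewrite catf0; apply: ty_lab.
- by move=> Phi c pPhi s G' Q' /subst_typed_param[] // ? -> _;
    rewrite catf0; apply: ty_cst.
- by move=> Phi pPhi s G' Q' /subst_typed_param[] // ? -> _;
    rewrite catf0; apply: ty_star.
- move=> Phi G1 G2 Q1 Q2 N P A B sp dQ _ IN _ IP s G' Q' h dd.
  have [Phi' [D1 [D2 [Q1' [Q2' [[sp' ->] [? ->] [? ?] s1 s2]]]]]] :=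
    subst_typed_splits sp dQ dd h.
  apply: (ty_let (A := A)) => //; first exact: IN.
  by apply: IP => //; apply: subst_typed_bind.
- by move=> G Q N A _ IN s G' Q' h dd; apply: ty_abort; apply: IN.
- by move=> G Q N A B _ IN s G' Q' h dd; apply: ty_inl; apply: IN.
- by move=> G Q N A B _ IN s G' Q' h dd; apply: ty_inr; apply: IN.
- move=> Phi G1 G2 Q1 Q2 N P P' A B D sp dQ _ IN _ IP _ IP' s G' Q' h dd.
  have [Phi' [D1 [D2 [Q1' [Q2' [[sp' ->] [? ->] [? ?] s1 s2]]]]]] :=
    subst_typed_splits sp dQ dd h.
  apply: (ty_case (A := A) (B := B)) => //; first exact: IN.
    by apply: IP => //; apply: subst_typed_bind.
  by apply: IP' => //; apply: subst_typed_bind.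
- move=> Phi G1 G2 Q1 Q2 N P A sp dQ _ IN _ IP s G' Q' h dd.
  have [Phi' [D1 [D2 [Q1' [Q2' [[sp' ->] [? ->] [? ?] s1 s2]]]]]] :=
    subst_typed_splits sp dQ dd h.
  by apply: ty_seq => //; [apply: IN | apply: IP].
- move=> Phi G1 G2 Q1 Q2 N P A B sp dQ _ IN _ IP s G' Q' h dd.
  have [Phi' [D1 [D2 [Q1' [Q2' [[sp' ->] [? ->] [? ?] s1 s2]]]]]] :=
    subst_typed_splits sp dQ dd h.
  by apply: ty_pair => //; [apply: IN | apply: IP].
- move=> Phi G1 G2 Q1 Q2 N P A B D sp dQ _ IN _ IP s G' Q' h dd.
  have [Phi' [D1 [D2 [Q1' [Q2' [[sp' ->] [? ->] [? ?] s1 s2]]]]]] :=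
    subst_typed_splits sp dQ dd h.
  apply: (ty_letpair (A := A) (B := B)) => //; first exact: IN.
  by apply: IP => //; do 2!apply: subst_typed_bind.
- move=> G Q N A B _ IN s G' Q' h dd; apply: ty_lam; apply: IN => //.
  exact: subst_typed_bind.
- move=> Phi G1 G2 Q1 Q2 N P A B sp dQ _ IN _ IP s G' Q' h dd.
  have [Phi' [D1 [D2 [Q1' [Q2' [[sp' ->] [? ->] [? ?] s1 s2]]]]]] :=
    subst_typed_splits sp dQ dd h.
  by apply: (ty_app (A := A)) => //; [apply: IN | apply: IP].
- move=> Phi N A pPhi _ IN s G' Q' h dd.
  have [pG' eQ] := subst_typed_param h pPhi; subst Q'.
  by rewrite catf0; apply: ty_lift => //; rewrite -[[fmap]]catf0; apply: IN.
- by move=> G Q N A _ IN s G' Q' h dd; apply: ty_force; apply: IN.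
- by move=> G Q N T U _ IN s G' Q' h dd; apply: ty_box; apply: IN.
- move=> Phi G1 G2 Q1 Q2 N P T U sp dQ _ IN _ IP s G' Q' h dd.
  have [Phi' [D1 [D2 [Q1' [Q2' [[sp' ->] [? ->] [? ?] s1 s2]]]]]] :=
    subst_typed_splits sp dQ dd h.
  by apply: (ty_apply (T := T)) => //; [apply: IN | apply: IP].
move=> Phi k C k' T U pPhi tk _ tk' _ s G' Q' /subst_typed_param[] // ? -> _.
rewrite catf0; exact: ty_boxed.
Qed.

(** The identity substitution with an empty partial inverse: every variable of [Phi] counts as new,
    so it only has to have a parameter type. *)
Lemma typed_closed_weaken Q t A Phi :
  typed [fmap] Q t A -> param_ctx Phi -> typed Phi Q t A.
Proof.
move=> tt pPhi.
rewrite -(@typed_subst_id _ _ _ _ (Var _ _ _) tt); last by move=> i; right.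
rewrite -[Q]catf0; apply: (typed_subst tt); last by fmap_tac.
apply: (subst_var (p := fun=> None)) => // i A'.
by rewrite fnd_fmap0.
Qed.

(** A closed value meets the side conditions of [subst_closed]: it is invariant under shifting, can
    be weakened, and owns no labels at a parameter type. *)
Lemma subst_typed_value G s G' Q q i A :
  subst_typed G s G' Q -> G.[? i] = None -> is_value (s i) ->
  typed [fmap] q (s i) A -> disj Q q ->
  subst_typed G.[i <- A] s G' (Q + q).
Proof.
move=> sG Gi vs ts dq; apply: subst_closed => //.
- exact: closed_rename ts.
- by move=> Phi; apply: typed_closed_weaken.
- exact: value_param_labels ts vs _.
Qed.

Lemma subst_typed_nil s : subst_typed [fmap] s [fmap] [fmap].
Proof.
by apply: (subst_var (p := fun=> None)) => // i A; rewrite fnd_fmap0.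
Qed.

Lemma typed_subst1 Q1 Q2 P V A B :
  typed (bind [fmap] A) Q1 P B -> typed [fmap] Q2 V A -> is_value V ->
  disj Q1 Q2 -> typed [fmap] (Q1 + Q2) (subst1 P V) B.
Proof.
move=> tP tV vV dQ; apply: (typed_subst tP) => //.
have -> : bind [fmap] A = [fmap].[0 <- A].
  by apply/fmapP => -[|i]; rewrite fnd_bind fnd_set ?fnd_fmap0.
rewrite -[Q2]cat0f; apply: subst_typed_value => //.
- exact: subst_typed_nil.
- exact: fnd_fmap0.
- by fmap_tac.
Qed.

Lemma typed_subst2 Q Q1 Q2 P V1 V2 A1 A2 B :
  typed (bind (bind [fmap] A1) A2) Q P B ->
  typed [fmap] Q1 V1 A1 -> is_value V1 -> typed [fmap] Q2 V2 A2 -> is_value V2 ->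
  disj Q1 Q2 -> disj Q (Q1 + Q2) ->
  typed [fmap] (Q + (Q1 + Q2)) (subst2 P V1 V2) B.
Proof.
move=> tP tV1 vV1 tV2 vV2 d12 dQ; apply: (typed_subst tP) => //.
have -> : bind (bind [fmap] A1) A2 = [fmap].[1 <- A1].[0 <- A2].
  by apply/fmapP => -[|[|i]]; rewrite !(fnd_bind, fnd_set) ?fnd_fmap0.
apply: subst_typed_value => //; last by rewrite fnd_set fnd_fmap0.
rewrite -[Q1]cat0f; apply: subst_typed_value => //; try by fmap_tac.
- exact: subst_typed_nil.
- exact: fnd_fmap0.
Qed.

(** * Inversion for closed terms and typing of label tuples *)

(** Typing of label tuples by recursion on the tuple and its type, which shows how these determine
    the label context. *)
Fixpoint ltuple_typed Q (k : ltuple L) (T : mty W) : Prop :=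
  match k, T with
  | LLab l, MWire a => Q = [fmap].[l <- a]
  | LStar, MUnit => Q = [fmap]
  | LPair k1 k2, MTens T1 T2 => exists Q1 Q2,
      [/\ disj Q1 Q2, Q = Q1 + Q2, ltuple_typed Q1 k1 T1 & ltuple_typed Q2 k2 T2]
  | _, _ => False
  end.

(* The variable context is abstracted first, since [inversion] would otherwise
   take the equation [Phi + G1 + G2 = [fmap]] apart into its representation. *)
Ltac inv_closed h :=
  let G := fresh in let E := fresh in
  match type of h with typed ?G0 _ _ _ => remember G0 as G eqn:E in h end;
  inversion h; subst; clear h;
  try match goal with
  | e : catf (catf ?Phi ?G1) ?G2 = _ |- _ =>
      let E1 := fresh in let E2 := fresh in
      destruct (catf2_eq0 e) as [E1 E2];
      repeat match goal with
      | H : context [catf Phi G1] |- _ =>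
          lazymatch H with E1 => fail | e => fail | _ => rewrite E1 in H end
      | H : context [catf Phi G2] |- _ =>
          lazymatch H with E2 => fail | e => fail | _ => rewrite E2 in H end
      end; clear E1 E2
  end.

Definition split_labels Q (X Y : lctx -> Prop) : Prop :=
  exists Q1 Q2, [/\ Q = Q1 + Q2, disj Q1 Q2, X Q1 & Y Q2].

(** Gathers the inversion principles by the shape of the term, with the split variable contexts
    already collapsed to the empty one, so only labels remain to be split. *)
Definition closed_inversion Q t A : Prop :=
  match t with
  | Let N P => exists B, split_labels Q
      (fun Q1 => typed [fmap] Q1 N B) (fun Q2 => typed (bind [fmap] B) Q2 P A)
  | InL B1 B2 N => A = TySum B1 B2 /\ typed [fmap] Q N B1
  | InR B1 B2 N => A = TySum B1 B2 /\ typed [fmap] Q N B2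
  | Case N P1 P2 => exists B1 B2, split_labels Q
      (fun Q1 => typed [fmap] Q1 N (TySum B1 B2))
      (fun Q2 => typed (bind [fmap] B1) Q2 P1 A /\ typed (bind [fmap] B2) Q2 P2 A)
  | Seq N P => split_labels Q
      (fun Q1 => typed [fmap] Q1 N TyUnit) (fun Q2 => typed [fmap] Q2 P A)
  | Pair N P => exists B1 B2, A = TyTens B1 B2 /\ split_labels Q
      (fun Q1 => typed [fmap] Q1 N B1) (fun Q2 => typed [fmap] Q2 P B2)
  | LetPair N P => exists B1 B2, split_labels Q
      (fun Q1 => typed [fmap] Q1 N (TyTens B1 B2))
      (fun Q2 => typed (bind (bind [fmap] B1) B2) Q2 P A)
  | Lam B N => exists B', A = TyLolli B B' /\ typed (bind [fmap] B) Q N B'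
  | App N P => exists B, split_labels Q
      (fun Q1 => typed [fmap] Q1 N (TyLolli B A)) (fun Q2 => typed [fmap] Q2 P B)
  | Lift N => exists B, [/\ A = TyBang B, Q = [fmap] & typed [fmap] [fmap] N B]
  | Force N => typed [fmap] Q N (TyBang A)
  | Box T N => exists U : mty W, A = TyCirc T U /\
      typed [fmap] Q N (TyBang (TyLolli T U))
  | Apply N P => exists T U : mty W, A = ty_of_mty U /\ split_labels Q
      (fun Q1 => typed [fmap] Q1 N (TyCirc T U)) (fun Q2 => typed [fmap] Q2 P T)
  | Boxed k C k' => exists T U : mty W, [/\ A = TyCirc T U, Q = [fmap],
      typed [fmap] (src C) (tm_of_ltuple wob K k) T
      & typed [fmap] (tgt C) (tm_of_ltuple wob K k') U]
  | Star => A = TyUnit /\ Q = [fmap]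
  | Lab l => exists a, A = TyWire a /\ Q = [fmap].[l <- a]
  | _ => True
  end.

Lemma closed_inv Q t A : typed [fmap] Q t A -> closed_inversion Q t A.
Proof.
case: t => //= *; match goal with H : typed _ _ _ _ |- _ => inv_closed H end;
  rewrite /split_labels; repeat eexists; try eassumption.
Qed.

Lemma typed_closed_pair Q1 Q2 N P A B :
  typed [fmap] Q1 N A -> typed [fmap] Q2 P B -> disj Q1 Q2 ->
  typed [fmap] (Q1 + Q2) (Pair N P) (TyTens A B).
Proof.
move=> tN tP dQ.
have := @ty_pair _ _ wob _ _ _ cty _ _ _ Q1 Q2 N P A B (@splits0 W) dQ.
by rewrite !catf0; apply.
Qed.

Lemma typed_closed_app Q1 Q2 N P A B :
  typed [fmap] Q1 N (TyLolli A B) -> typed [fmap] Q2 P A -> disj Q1 Q2 ->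
  typed [fmap] (Q1 + Q2) (App N P) B.
Proof.
move=> tN tP dQ.
have := @ty_app _ _ wob _ _ _ cty _ _ _ Q1 Q2 N P A B (@splits0 W) dQ.
by rewrite !catf0; apply.
Qed.

Lemma ltuple_typedP Q k (T : mty W) :
  typed [fmap] Q (tm_of_ltuple wob K k) T <-> ltuple_typed Q k T.
Proof.
split.
  elim: k T Q => [l||k1 IH1 k2 IH2] [a||T1 T2] Q /closed_inv /=.
  - by move=> [b [[<-] ->]].
  - by move=> [b []].
  - by move=> [b []].
  - by move=> [].
  - by move=> [].
  - by move=> [].
  - by move=> [b1 [b2 []]].
  - by move=> [b1 [b2 []]].
  move=> [b1 [b2 [[<- <-] [Q1 [Q2 [-> dQ t1 t2]]]]]].
  by exists Q1, Q2; split; auto.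
elim: k T Q => [l||k1 IH1 k2 IH2] [a||T1 T2] Q //=.
- by move=> ->; apply: ty_lab; apply: param_ctx0.
- by move=> ->; apply: ty_star; apply: param_ctx0.
move=> [Q1 [Q2 [dQ -> h1 h2]]].
by apply: typed_closed_pair; auto.
Qed.

Lemma ltuple_typed_dom Q k T : ltuple_typed Q k T -> domf Q =i ltuple_labels k.
Proof.
elim: k T Q => [l||k1 IH1 k2 IH2] [a||T1 T2] Q //=.
- by move=> -> x; rewrite !inE orbF.
- by move=> -> x; rewrite !inE.
move=> [Q1 [Q2 [_ -> /IH1 h1 /IH2 h2]]] x.
by rewrite mem_cat mem_catf h1 h2.
Qed.

(** For a pair, [Q'] is cut along the images under [rho] of the two parts of [Q]; injectivity makes
    these images disjoint. *)
Lemma ltuple_typed_rename Q Q' k T rho :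
  ltuple_typed Q k T -> {in domf Q &, injective rho} ->
  domf Q' = [fset rho l | l in domf Q] ->
  (forall l, l \in domf Q -> Q'.[? rho l] = Q.[? l]) ->
  ltuple_typed Q' (ltuple_map rho k) T.
Proof.
elim: k T Q Q' => [l||k1 IH1 k2 IH2] [a||T1 T2] Q Q' //=.
- move=> -> _ dQ' vQ'; apply/fmapP => x; rewrite fnd_set fnd_fmap0.
  have ll : l \in domf [fmap].[l <- a] by rewrite mem_setf !inE.
  case: eqP => [->|ne]; first by rewrite vQ' // fnd_set eqxx.
  rewrite notin_fnd // dQ'; apply/imfsetP => -[y /=].
  by rewrite !inE orbF => /eqP->.
- move=> -> _ dQ' _; apply/fmapP => x; rewrite fnd_fmap0; apply: notin_fnd.
  by rewrite dQ'; apply/imfsetP => -[].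
move=> [Q1 [Q2 [dQ eQ h1 h2]]] inj dQ' vQ'.
have m1 l : l \in domf Q1 -> l \in domf Q by rewrite eQ mem_catf => ->.
have m2 l : l \in domf Q2 -> l \in domf Q by rewrite eQ mem_catf orbC => ->.
have v1 l : l \in domf Q1 -> Q.[? l] = Q1.[? l].
  move=> l1; rewrite eQ fnd_catr; case: (disjP _ _ dQ l) => [e|-> //].
  by move/fnd_domP: l1.
have v2 l : l \in domf Q2 -> Q.[? l] = Q2.[? l].
  by move=> l2; rewrite eQ fnd_catr; move/fnd_domP: l2; case: (Q2.[? l]).
pose im (Qi : lctx) := [fset rho l | l in domf Qi].
(* Restricting [Q'] to the image of a part of [Q] gives a renaming of that part, as the induction
   hypotheses require. *)
have sub (Qi : lctx) : (forall l, l \in domf Qi -> l \in domf Q) ->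
    (forall l, l \in domf Qi -> Q.[? l] = Qi.[? l]) ->
    domf Q'.[& im Qi] = im Qi /\
    (forall l, l \in domf Qi -> Q'.[& im Qi].[? rho l] = Qi.[? l]).
  move=> mi vi; split; last first.
    move=> l li; rewrite fnd_restrict in_imfset //= vQ' ?vi //; exact: mi.
  apply/fsetP => x; rewrite mem_restrictf andb_idr // => /imfsetP[l /= li ->].
  by suff: rho l \in domf Q' by []; rewrite dQ' in_imfset //= mi.
have [d1 w1] := sub _ m1 v1; have [d2 w2] := sub _ m2 v2.
exists Q'.[& im Q1], Q'.[& im Q2]; split.
- apply/(@fdisjointP _ _ _) => x; rewrite d1 d2 => /imfsetP[l /= l1 ->].
  apply/imfsetP => -[l' /= l2] /inj ell'.
  have := fdisjointP dQ l l1; rewrite ell' ?l2 //; [exact: m1|exact: m2].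
- apply/fmapP => x; rewrite fnd_catr !fnd_restrict.
  case: ifP => [_|x2]; first by case: ifP => x1; case: (Q'.[? x]).
  case: ifP => // x1; rewrite notin_fnd // dQ'; apply/imfsetP => -[l /= lQ ex].
  move: lQ; rewrite eQ mem_catf => /orP[li|li].
    by move: x1; rewrite ex in_imfset.
  by move: x2; rewrite ex in_imfset.
- by apply: (IH1 _ _ _ h1) => // x y /m1 ? /m1 ?; apply: inj.
- by apply: (IH2 _ _ _ h2) => // x y /m2 ? /m2 ?; apply: inj.
Qed.

(** * Preservation of typing by [append] and by evaluation *)

(** The inputs of the renamed circuit and [Qk] both have exactly the labels of [k] as domain, so
    their complements in the outputs of [C] agree. The new outputs [tgt D'] type [k'] because they
    rename [tgt D], which types [l']. *)
Lemma append_typed (C D C' : lcirc) k l l' k' Qk R T U :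
  append C k l D l' C' k' -> tgt C = Qk + R -> disj Qk R ->
  ltuple_typed Qk k T -> ltuple_typed (tgt D) l' U ->
  exists Qk', [/\ src C' = src C, tgt C' = Qk' + R, disj Qk' R
    & ltuple_typed Qk' k' U].
Proof.
case=> {C k l D l' C' k'} Q0 R' D D' C s m k l l' k' rho rho'.
move=> [r [r' [_ [inj dD'0 vD' _] _]]] _ -> _ dk dR dD' _ _ _ /= eQ dQ tk tl'.
exists (tgt D').
have ed x : (x \in domf (src D')) = (x \in domf Qk).
  by rewrite dk (ltuple_typed_dom tk).
have eR : R' = R.
  apply/fmapP => x; move: (ed x) (disjP _ _ dR x) (disjP _ _ dQ x).
  move: (fnd_eq x eQ); rewrite !fnd_catr.
  case: (fndP (src D') x) => x1; case: (fndP Qk x) => x2 //.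
    by move=> _ _ [] // -> [] // ->.
  by case: (R'.[? x]) => [?|]; case: (R.[? x]).
subst R'; split=> //; first by fmap_tac.
exact: ltuple_typed_rename tl' inj dD'0 vD'.
Qed.

Lemma eval_typed (c c' : config wob L K) :
  eval cty c c' -> forall Q A Q',
  typed_config cty Q c A Q' -> typed_config cty Q c' A Q'.
Proof.
elim=> {c c'}; try by [].
- move=> C C' C'' N P V V' eN IN eP IP Q A R [Q0 /= [dQ sC tC /closed_inv]].
  move=> /= [B [Q1 [Q2 [eQ0 dQ12 tN tP]]]]; subst Q0.
  (* While [N] is evaluated, the labels [Q2] of the body wait in the frame; afterwards they are
     joined by those of the value. *)
  have [|Q1' /= [d1 s1 t1 tV]] := IN Q B (Q2 + R).
    by exists Q1; split=> //=; fmap_tac.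
  apply: IP; exists (Q2 + Q1'); split=> //=; try fmap_tac.
  by apply: typed_subst1 tP tV (eval_value eN) _; fmap_tac.
- move=> C C' B1 B2 N V eN IN Q A R [Q0 /= [dQ sC tC /closed_inv /= [-> tN]]].
  have [|Q1' /= [d1 s1 t1 tV]] := IN Q B1 R; first by exists Q0.
  by exists Q1'; split=> //; apply: ty_inl.
- move=> C C' B1 B2 N V eN IN Q A R [Q0 /= [dQ sC tC /closed_inv /= [-> tN]]].
  have [|Q1' /= [d1 s1 t1 tV]] := IN Q B2 R; first by exists Q0.
  by exists Q1'; split=> //; apply: ty_inr.
- move=> C C' C'' A1 A2 N P P' V V' eN IN eP IP Q A R [Q0 /= [dQ sC tC /closed_inv]].
  move=> /= [B1 [B2 [Q1 [Q2 [eQ0 dQ12 tN [tP _]]]]]]; subst Q0.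
  have [|Q1' /= [d1 s1 t1 /closed_inv /= [[? ?] tV]]] := IN Q (TySum B1 B2) (Q2 + R).
    by exists Q1; split=> //=; fmap_tac.
  subst A1 A2; apply: IP; exists (Q2 + Q1'); split=> //=; try fmap_tac.
  by apply: typed_subst1 tP tV (eval_value eN) _; fmap_tac.
- move=> C C' C'' A1 A2 N P P' V V' eN IN eP IP Q A R [Q0 /= [dQ sC tC /closed_inv]].
  move=> /= [B1 [B2 [Q1 [Q2 [eQ0 dQ12 tN [_ tP]]]]]]; subst Q0.
  have [|Q1' /= [d1 s1 t1 /closed_inv /= [[? ?] tV]]] := IN Q (TySum B1 B2) (Q2 + R).
    by exists Q1; split=> //=; fmap_tac.
  subst A1 A2; apply: IP; exists (Q2 + Q1'); split=> //=; try fmap_tac.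
  by apply: typed_subst1 tP tV (eval_value eN) _; fmap_tac.
- move=> C C' C'' N P V' eN IN eP IP Q A R [Q0 /= [dQ sC tC /closed_inv]].
  move=> /= [Q1 [Q2 [eQ0 dQ12 tN tP]]]; subst Q0.
  (* The value [Star] owns no labels, so [P] runs with [Q2] alone. *)
  have [|Q1' /= [d1 s1 t1 /closed_inv /= [_ e1]]] := IN Q TyUnit (Q2 + R).
    by exists Q1; split=> //=; fmap_tac.
  by subst Q1'; apply: IP; exists Q2; split=> //=; fmap_tac.
- move=> C C' C'' N P V V' eN IN eP IP Q A R [Q0 /= [dQ sC tC /closed_inv]].
  move=> /= [B1 [B2 [-> [Q1 [Q2 [eQ0 dQ12 tN tP]]]]]]; subst Q0.
  have [|Q1' /= [d1 s1 t1 tV]] := IN Q B1 (Q2 + R).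
    by exists Q1; split=> //=; fmap_tac.
  (* The roles are exchanged: the labels of the first value now wait in the frame. *)
  have [|Q2' /= [d2 s2 t2 tV']] := IP Q B2 (Q1' + R).
    by exists Q2; split=> //=; fmap_tac.
  exists (Q1' + Q2'); split=> //=; try fmap_tac.
  by apply: typed_closed_pair => //; fmap_tac.
- move=> C C' C'' N P V1 V2 V' eN IN eP IP Q A R [Q0 /= [dQ sC tC /closed_inv]].
  move=> /= [B1 [B2 [Q1 [Q2 [eQ0 dQ12 tN tP]]]]]; subst Q0.
  have [|Q1' /= [d1 s1 t1 /closed_inv]] := IN Q (TyTens B1 B2) (Q2 + R).
    by exists Q1; split=> //=; fmap_tac.
  move=> /= [A1 [A2 [[? ?] [q1 [q2 [e12 d12 tV1 tV2]]]]]]; subst A1 A2 Q1'.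
  have /andP[vV1 vV2] := eval_value eN.
  apply: IP; exists (Q2 + (q1 + q2)); split=> //=; try fmap_tac.
  by apply: typed_subst2 tP tV1 vV1 tV2 vV2 _ _ => //; fmap_tac.
- move=> C C' C'' C3 N P B0 N' V V' eN IN eP IP eW IW Q A R.
  move=> [Q0 /= [dQ sC tC /closed_inv]].
  move=> /= [B [Q1 [Q2 [eQ0 dQ12 tN tP]]]]; subst Q0.
  have [|Q1' /= [d1 s1 t1 /closed_inv /= [B' [[? ?] tN']]]] := IN Q (TyLolli B A) (Q2 + R).
    by exists Q1; split=> //=; fmap_tac.
  subst B0 B'.
  have [|Q2' /= [d2 s2 t2 tV]] := IP Q B (Q1' + R).
    by exists Q2; split=> //=; fmap_tac.
  apply: IW; exists (Q1' + Q2'); split=> //=; try fmap_tac.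
  by apply: typed_subst1 tN' tV (eval_value eP) _; fmap_tac.
- move=> C C' C'' N N' V eN IN eP IP Q A R [Q0 /= [dQ sC tC /closed_inv /= tN]].
  have [|Q1' /= [d1 s1 t1 /closed_inv /= [B [[?] ? tN']]]] := IN Q (TyBang A) R.
    by exists Q0.
  (* A lifted term owns no labels, so all outputs belong to the frame [R]. *)
  by subst B Q1'; apply: IP; exists [fmap].
- move=> C C' D T N N' q k k' eN IN [tk _] eB IB Q A R.
  move=> [Q0 /= [dQ sC tC /closed_inv /= [U [-> tN]]]].
  have [|Q1' /= [d1 s1 t1 /closed_inv /= [B [[?] ? tN']]]] :=
    IN Q (TyBang (TyLolli T U)) R; first by exists Q0.
  subst B Q1'.
  (* The inner evaluation starts from the identity on [q] with an empty frame, so the outputs of [D]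
     are exactly the labels that type [k']. *)
  have [|Q2 /= [_ s2 t2 tk']] := IB q U [fmap].
    exists q; split=> //=; try by fmap_tac.
    by rewrite -[q]cat0f; apply: typed_closed_app tN' tk _; fmap_tac.
  exists [fmap]; split=> //=; apply: ty_boxed; first exact: param_ctx0.
    by rewrite s2; apply: tk.
  by rewrite t2 catf0; apply: tk'.
move=> C C' C'' C3 N P k l D l' k' eN IN eP IP ap Q A R.
move=> [Q0 /= [dQ sC tC /closed_inv]].
move=> /= [T [U [-> [Q1 [Q2 [eQ0 dQ12 tN tP]]]]]]; subst Q0.
have [|Q1' /= [d1 s1 t1 /closed_inv]] := IN Q (TyCirc T U) (Q2 + R).
  by exists Q1; split=> //=; fmap_tac.
move=> /= [T' [U' [[? ?] ? _ tl']]]; subst T' U' Q1'.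
(* A boxed circuit owns no labels, so the frame for the argument is just [R]. *)
have [|Q2' /= [d2 s2 t2 tk]] := IP Q T R.
  by exists Q2; split=> //=; fmap_tac.
have [Qk [s3 t3 d3 tk']] := append_typed ap t2 d2 ((ltuple_typedP _ _ _).1 tk)
   ((ltuple_typedP _ _ _).1 tl').
exists Qk; split=> //=; first by rewrite s3.
exact/ltuple_typedP.
Qed.

End SubjectReduction.

Theorem proposition5p2 (M : smc) (W : Type) (wob : W -> ob M)
    (d : Order.disp_t) (L : orderType d)
    (hL : exists f : nat -> L, bijective f)
    (K : Type) (cty : K -> ty W)
    (Q Q' : lctx W L) (C C' : lcirc wob L) (N V : tm wob L K) (A : ty W) :
  typed_config cty Q (C, N) A Q' ->
  eval cty (C, N) (C', V) ->
  typed_config cty Q (C', V) A Q'.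
Proof.
by move=> tN e; apply: eval_typed e _ _ _ tN.
Qed.
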